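(* \[\frac{\varpi}{2}=\prod_{n=1}^\infty\left(1-\frac{1}{2n(4n-1)}\right)^{-1},\] where $\varpi$ is the lemniscate constant.
   Context: The lemniscate constant is $\varpi:=2\int_0^1\frac{dt}{\sqrt{1-t^4}}=2.6220\ldots$. *)

(* Defs.v *)
From Stdlib Require Import Reals.
From Coquelicot Require Import Coquelicot.

Open Scope R_scope.

(* Improper Riemann integral: the integrand is unbounded at the endpoint 1. *)
Definition lemniscate : R :=
  2 * RInt_gen (fun t => 1 / sqrt (1 - t ^ 4)) (at_point 0) (at_left 1).

(* [prod_f_R0 f N] is [f 0 * ... * f N], so the partial products of
   [a 1 * a 2 * ...] require an index shift. *)
Definition is_infinite_product_from1 (a : nat -> R) (l : R) : Prop :=
  is_lim_seq (fun N => prod_f_R0 (fun k => a (S k)) N) l.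

(* Main.v *)
(** Put [I k := RInt (t^k / sqrt (1 - t^4)) 0 1].  Integrating the derivative of
    [t^(k+1) sqrt (1 - t^4)] gives [I (k+4) = (k+1)/(k+3) * I k], so that
    [I (4N)] is an explicit product times [I 0 = lemniscate / 2], while
    [I (4N+3)] is an explicit product times [I 3 = 1/2].  The inequalities
    [I (4N+4) <= I (4N+3) <= I (4N)] then squeeze the partial products, exactly
    as in the classical proof of Wallis' formula. *)

Require Import Defs.
From Stdlib Require Import Reals Lra Lia.
From Coquelicot Require Import Coquelicot.

Open Scope R_scope.

(** * Truncated moments: proper integrals over [[0, x]] with [x < 1] *)

Definition lemn_integrand (k : nat) (t : R) : R := t ^ k / sqrt (1 - t ^ 4).

(** Stopping at [x < 1] keeps every integral proper; the moment [I k] of the overview is the limit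
    as [x] tends to 1 from the left. *)
Definition lemn_moment (k : nat) (x : R) : R := RInt (lemn_integrand k) 0 x.

Lemma one_minus_pow4_pos (t : R) : 0 <= t < 1 -> 0 < 1 - t ^ 4.
Proof.
intros [H0 H1].
assert (Ht : t ^ 4 < 1) by (apply pow_lt_1_compat; [lra | lia]).
lra.
Qed.

Lemma continuous_lemn_integrand (k : nat) (t : R) :
  0 <= t < 1 -> continuous (lemn_integrand k) t.
Proof.
intros Ht.
apply (ex_derive_continuous (K := R_AbsRing) (V := R_NormedModule)).
assert (Hp := one_minus_pow4_pos t Ht).
assert (Hs := sqrt_lt_R0 _ Hp).
unfold lemn_integrand; auto_derive.
repeat split; [exact Hp | apply Rgt_not_eq; exact Hs].
Qed.

Lemma ex_RInt_lemn_integrand (k : nat) (x y : R) :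
  0 <= x <= y -> y < 1 -> ex_RInt (lemn_integrand k) x y.
Proof.
intros Hx Hy.
apply (ex_RInt_continuous (V := R_CompleteNormedModule)).
intros z; rewrite Rmin_left, Rmax_right by lra; intros Hz.
apply continuous_lemn_integrand; lra.
Qed.

Lemma lemn_integrand_ge0 (k : nat) (t : R) : 0 <= t < 1 -> 0 <= lemn_integrand k t.
Proof.
intros Ht.
apply Rdiv_le_0_compat.
- apply pow_le; lra.
- apply sqrt_lt_R0, one_minus_pow4_pos, Ht.
Qed.

Lemma lemn_moment_succ_le (k : nat) (x : R) :
  0 <= x < 1 -> lemn_moment (S k) x <= lemn_moment k x.
Proof.
intros Hx.
apply RInt_le; [lra | apply ex_RInt_lemn_integrand; lra .. |].
intros t Ht.
assert (Hk := lemn_integrand_ge0 k t ltac:(lra)).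
replace (lemn_integrand (S k) t) with (t * lemn_integrand k t)
  by (unfold lemn_integrand, Rdiv; simpl; ring).
nra.
Qed.

Lemma lemn_moment_antitone (j k : nat) (x : R) :
  (j <= k)%nat -> 0 <= x < 1 -> lemn_moment k x <= lemn_moment j x.
Proof.
intros Hjk Hx; induction Hjk as [| k _ IH]; [lra |].
eapply Rle_trans; [apply lemn_moment_succ_le, Hx | exact IH].
Qed.

Lemma lemn_moment_incr (k : nat) (x y : R) :
  0 <= x <= y -> y < 1 -> lemn_moment k x <= lemn_moment k y.
Proof.
intros Hx Hy; unfold lemn_moment.
rewrite <- (RInt_Chasles (lemn_integrand k) 0 x y)
  by (apply ex_RInt_lemn_integrand; lra).
assert (H : 0 <= RInt (lemn_integrand k) x y).
{ apply RInt_ge_0; [lra | apply ex_RInt_lemn_integrand; lra |].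
  intros t Ht; apply lemn_integrand_ge0; lra. }
unfold plus; simpl; lra.
Qed.

(** * Recursion, a closed form and a uniform bound before the limit *)

(** The derivative of [t^(k+1) sqrt (1 - t^4)] is [((k+1) t^k (1 - t^4) - 2 t^(k+4)) / sqrt (1 -
    t^4)], a combination of the integrands [k] and [k + 4]. The boundary term survives for [x < 1]
    and vanishes only in the limit. *)
Lemma lemn_moment_rec (k : nat) (x : R) :
  0 <= x < 1 ->
  (INR k + 3) * lemn_moment (k + 4) x =
  (INR k + 1) * lemn_moment k x - x ^ (k + 1) * sqrt (1 - x ^ 4).
Proof.
intros Hx.
set (g := fun t => t ^ (k + 1) * sqrt (1 - t ^ 4)).
set (dg := fun t => (INR k + 1) * lemn_integrand k t
                    - (INR k + 3) * lemn_integrand (k + 4) t).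
assert (Hg : is_RInt dg 0 x (minus (g x) (g 0))).
{ apply (is_RInt_derive (V := R_CompleteNormedModule)); intros t;
    rewrite Rmin_left, Rmax_right by lra; intros Ht.
  - assert (Hp := one_minus_pow4_pos t ltac:(lra)).
    assert (Hs := sqrt_lt_R0 _ Hp).
    unfold g, dg, lemn_integrand; auto_derive; [simpl in *; lra |].
    replace (1 + - (t * (t * (t * (t * 1))))) with (1 - t ^ 4) by (simpl; ring).
    replace (k + 1)%nat with (S k) by lia.
    rewrite S_INR, pow_add; simpl Init.Nat.pred.
    assert (Hq : sqrt (1 - t ^ 4) * sqrt (1 - t ^ 4) = 1 - t ^ 4)
      by (apply sqrt_sqrt; lra).
    apply Rmult_eq_reg_r with (sqrt (1 - t ^ 4)); [| lra].
    (* The middle expression is the derivative times the root; it leaves the square of the root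
       unexpanded so that [Hq] can replace it by [1 - t^4]. *)
    match goal with |- ?l = ?r =>
      transitivity ((INR k + 1) * t ^ k * (sqrt (1 - t ^ 4) * sqrt (1 - t ^ 4))
                    - 2 * t ^ (S k) * t ^ 3) end.
    + simpl; field; simpl in *; lra.
    + rewrite Hq; simpl; field; simpl in *; lra.
  - unfold dg.
    apply (continuous_minus (V := R_NormedModule));
      apply (continuous_mult (K := R_AbsRing));
      try apply continuous_const; apply continuous_lemn_integrand; lra. }
assert (Hd : is_RInt dg 0 x
  ((INR k + 1) * lemn_moment k x - (INR k + 3) * lemn_moment (k + 4) x)).
{ apply (is_RInt_minus (V := R_NormedModule));
    apply (is_RInt_scal (V := R_NormedModule));
    apply (RInt_correct (V := R_CompleteNormedModule));
    apply ex_RInt_lemn_integrand; lra. }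
assert (E := eq_trans (eq_sym (is_RInt_unique _ _ _ _ Hg)) (is_RInt_unique _ _ _ _ Hd)).
unfold g, minus, plus, opp in E; simpl in E |- *.
rewrite (Nat.add_comm k 1) in E |- *; simpl in E |- *.
lra.
Qed.

(** The factor [t^3] makes the integrand elementary, with antiderivative [- sqrt (1 - t^4) / 2]. *)
Lemma lemn_moment_3 (x : R) :
  0 <= x < 1 -> lemn_moment 3 x = (1 - sqrt (1 - x ^ 4)) / 2.
Proof.
intros Hx.
set (g := fun t => - sqrt (1 - t ^ 4) / 2).
replace ((1 - sqrt (1 - x ^ 4)) / 2) with (minus (g x) (g 0)).
2: { unfold g, minus, plus, opp; simpl.
     rewrite Rmult_0_l, Rminus_0_r, sqrt_1; lra. }
apply is_RInt_unique, (is_RInt_derive (V := R_CompleteNormedModule)); intros t;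
  rewrite Rmin_left, Rmax_right by lra; intros Ht.
- assert (Hp := one_minus_pow4_pos t ltac:(lra)).
  assert (Hs := sqrt_lt_R0 _ Hp).
  unfold g, lemn_integrand; auto_derive; [simpl in *; lra |].
  replace (1 + - (t * (t * (t * (t * 1))))) with (1 - t ^ 4) by (simpl; ring).
  simpl in *; field; lra.
- apply continuous_lemn_integrand; lra.
Qed.

(** With [s = sqrt (1 - x^4)], the recursion at [k = 0] and moment 4 [<=] moment 3 [= (1 - s) / 2]
    bound moment 0 by [3 (1 - s) / 2 + x s]. The constant is not sharp: any bound uniform in [x]
    gives convergence. *)
Lemma lemn_moment_0_bound (x : R) : 0 <= x < 1 -> lemn_moment 0 x <= 5 / 2.
Proof.
intros Hx.
assert (H4 := lemn_moment_rec 0 x Hx).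
assert (H34 := lemn_moment_succ_le 3 x Hx).
assert (H3 := lemn_moment_3 x Hx).
assert (Hp := one_minus_pow4_pos x Hx).
assert (Hs := sqrt_pos (1 - x ^ 4)).
assert (Hs1 : sqrt (1 - x ^ 4) <= 1).
{ apply Rle_trans with (sqrt 1); [apply sqrt_le_1_alt | rewrite sqrt_1; lra].
  assert (H := pow_le x 4 (proj1 Hx)); lra. }
simpl Nat.add in H4; simpl INR in H4; rewrite pow_1 in H4.
nra.
Qed.

(** * Limits of the moments at the endpoint 1 *)

Lemma at_left_1_unit : at_left 1 (fun x => 0 <= x < 1).
Proof.
exists (mkposreal 1 Rlt_0_1); intros y Hy Hy1.
apply Rabs_def2 in Hy; unfold minus, plus, opp in Hy; simpl in Hy; lra.
Qed.

Lemma filterlim_at_left_1 (f : R -> R) :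
  continuous f 1 -> filterlim f (at_left 1) (locally (f 1)).
Proof.
intros Hf; eapply filterlim_filter_le_1; [| exact Hf].
apply filter_le_within.
Qed.

(** The truncated integral is nondecreasing and bounded in [x], hence converges to its supremum. *)
Lemma lemn_moment_0_cv :
  exists L, filterlim (lemn_moment 0) (at_left 1) (locally L).
Proof.
set (E := fun y => exists x, 0 <= x < 1 /\ y = lemn_moment 0 x).
destruct (completeness E) as [L [HL1 HL2]].
- exists (5 / 2); intros y [x [Hx ->]]; apply lemn_moment_0_bound, Hx.
- exists (lemn_moment 0 0), 0; split; [lra | reflexivity].
- exists L; apply filterlim_locally; intros eps.
  assert (Hex : exists x, 0 <= x < 1 /\ L - eps < lemn_moment 0 x).
  { apply Classical_Prop.NNPP; intros Hn.
    assert (Hb : L <= L - eps).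
    { apply HL2; intros y [x [Hx ->]]; apply Rnot_lt_le; intros Hlt.
      apply Hn; now exists x. }
    assert (He := cond_pos eps); lra. }
  destruct Hex as [x0 [Hx0 Hlt]].
  assert (Hpos : 0 < 1 - x0) by lra.
  exists (mkposreal _ Hpos); intros y Hy Hy1.
  apply Rabs_def2 in Hy; unfold minus, plus, opp in Hy; simpl in Hy.
  assert (Hm := lemn_moment_incr 0 x0 y ltac:(lra) Hy1).
  assert (HM : lemn_moment 0 y <= L) by (apply HL1; exists y; split; [lra | reflexivity]).
  assert (He := cond_pos eps).
  apply Rabs_def1; unfold minus, plus, opp; simpl; lra.
Qed.

(** Since [at_point 0] pins the lower endpoint, convergence along the product filter reduces to that
    of the upper endpoint. *)
Lemma lemniscate_half_of_cv (L : R) :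
  filterlim (lemn_moment 0) (at_left 1) (locally L) -> lemniscate / 2 = L.
Proof.
intros HL; unfold lemniscate.
assert (H : is_RInt_gen (fun t => 1 / sqrt (1 - t ^ 4)) (at_point 0) (at_left 1) L).
{ intros P HP.
  apply (Filter_prod _ _ _ (fun x => x = 0)
           (fun y => 0 <= y < 1 /\ P (lemn_moment 0 y))).
  - reflexivity.
  - apply filter_and; [exact at_left_1_unit | exact (HL P HP)].
  - intros x y -> [Hy HPy]; exists (lemn_moment 0 y); split; [| exact HPy].
    apply (RInt_correct (V := R_CompleteNormedModule) (lemn_integrand 0)).
    apply ex_RInt_lemn_integrand; simpl; lra. }
rewrite (is_RInt_gen_unique _ _ H); lra.
Qed.

Lemma lemn_moment_cv_step (k : nat) (l : R) :
  filterlim (lemn_moment k) (at_left 1) (locally l) ->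
  filterlim (lemn_moment (k + 4)) (at_left 1)
    (locally ((INR k + 1) / (INR k + 3) * l)).
Proof.
intros Hl.
assert (Hk := pos_INR k).
(* The boundary term of the recursion, divided by [k + 3]. It is continuous on both sides of 1,
   [sqrt] being 0 on negative reals, and [h 1 = 0]. *)
set (h := fun x => - / (INR k + 3) * (x ^ (k + 1) * sqrt (1 - x ^ 4))).
assert (Hh : filterlim h (at_left 1) (locally 0)).
{ replace 0 with (h 1)
    by (unfold h; rewrite !pow1, Rminus_diag, sqrt_0; ring).
  apply filterlim_at_left_1; unfold h.
  apply (continuous_mult (K := R_AbsRing)); [apply continuous_const |].
  apply (continuous_mult (K := R_AbsRing)).
  - apply (ex_derive_continuous (K := R_AbsRing) (V := R_NormedModule)).
    auto_derive; trivial.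
  - apply (continuous_comp (fun x => 1 - x ^ 4) sqrt).
    + apply (ex_derive_continuous (K := R_AbsRing) (V := R_NormedModule)).
      auto_derive; trivial.
    + apply continuous_sqrt. }
rewrite <- (Rplus_0_r ((INR k + 1) / (INR k + 3) * l)).
apply filterlim_ext_loc with
  (f := fun x => (INR k + 1) / (INR k + 3) * lemn_moment k x + h x).
- apply filter_imp with (2 := at_left_1_unit); intros x Hx; unfold h.
  apply Rmult_eq_reg_l with (INR k + 3); [| lra].
  rewrite (lemn_moment_rec k x Hx); field; lra.
- eapply filterlim_comp_2; [| exact Hh | apply (filterlim_plus (V := R_NormedModule))].
  eapply filterlim_comp; [exact Hl |].
  apply (filterlim_scal_r (K := R_AbsRing) (V := R_NormedModule)).
Qed.

(** This is [I (r + 4N) / I r], obtained by iterating the recursion [N] times. *)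
Fixpoint moment_ratio (r N : nat) : R :=
  match N with
  | O => 1
  | S n => (INR (r + 4 * n) + 1) / (INR (r + 4 * n) + 3) * moment_ratio r n
  end.

Lemma moment_ratio_gt0 (r N : nat) : 0 < moment_ratio r N.
Proof.
induction N as [| N IH]; cbn [moment_ratio]; [lra |].
assert (H := pos_INR (r + 4 * N)).
apply Rmult_lt_0_compat; [apply Rdiv_lt_0_compat; lra | exact IH].
Qed.

Lemma lemn_moment_cv (r N : nat) (l : R) :
  filterlim (lemn_moment r) (at_left 1) (locally l) ->
  filterlim (lemn_moment (r + 4 * N)) (at_left 1) (locally (moment_ratio r N * l)).
Proof.
intros Hl; induction N as [| N IH].
- rewrite Nat.mul_0_r, Nat.add_0_r; simpl; rewrite Rmult_1_l; exact Hl.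
- replace (r + 4 * S N)%nat with (r + 4 * N + 4)%nat by lia.
  cbn [moment_ratio]; rewrite Rmult_assoc.
  apply lemn_moment_cv_step, IH.
Qed.

Lemma lemn_moment_3_cv :
  filterlim (lemn_moment 3) (at_left 1) (locally (1 / 2)).
Proof.
set (h := fun x => (1 - sqrt (1 - x ^ 4)) * / 2).
apply filterlim_ext_loc with (f := h).
- apply filter_imp with (2 := at_left_1_unit); intros x Hx.
  now rewrite lemn_moment_3.
- replace (1 / 2) with (h 1)
    by (unfold h; rewrite pow1, Rminus_diag, sqrt_0; field).
  apply filterlim_at_left_1; unfold h.
  apply (continuous_mult (K := R_AbsRing)); [| apply continuous_const].
  apply (continuous_minus (V := R_NormedModule)); [apply continuous_const |].
  apply (continuous_comp (fun x => 1 - x ^ 4) sqrt).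
  + apply (ex_derive_continuous (K := R_AbsRing) (V := R_NormedModule)).
    auto_derive; trivial.
  + apply continuous_sqrt.
Qed.

Lemma lemn_moment_lim_antitone (j k : nat) (l l' : R) :
  (j <= k)%nat ->
  filterlim (lemn_moment j) (at_left 1) (locally l) ->
  filterlim (lemn_moment k) (at_left 1) (locally l') ->
  l' <= l.
Proof.
intros Hjk Hl Hl'.
change (Rbar_le l' l).
apply (filterlim_le (F := at_left 1) (lemn_moment k) (lemn_moment j));
  [| exact Hl' | exact Hl].
apply filter_imp with (2 := at_left_1_unit); intros x Hx.
now apply lemn_moment_antitone.
Qed.

(** * Partial products and the squeeze *)

(** The [n]-th factor is [4n (4n-1) / ((4n+1) (4n-2))], whereas the quotient of the two ratios
    contributes [4n (4n-1) / ((4n+2) (4n-3))]. The discrepancy telescopes to [(4M+2) / (2 (4M+1))]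
    with [M = S N], the number of factors in the product up to index [N]. *)
Lemma partial_product_moment_ratio (N : nat) :
  prod_f_R0 (fun k => / (1 - 1 / (2 * INR (S k) * (4 * INR (S k) - 1)))) N =
  (4 * INR (S N) + 2) / (4 * INR (S N) + 1)
  * (moment_ratio 3 (S N) * (1 / 2)) / moment_ratio 0 (S N).
Proof.
induction N as [| N IH].
- simpl; field.
- cbn [prod_f_R0]; rewrite IH.
  remember (S N) as M eqn:HM.
  assert (HMpos : 1 <= INR M) by (subst M; rewrite S_INR; assert (H := pos_INR N); lra).
  assert (Ha := moment_ratio_gt0 0 M).
  cbn [moment_ratio].
  rewrite (S_INR M), !plus_INR, mult_INR.
  replace (INR 4) with 4 by (simpl; ring); replace (INR 3) with 3 by (simpl; ring).
  simpl (INR 0).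
  (* Shows that the new factor [1 - 1 / (...)] is nonzero, as [field] requires to simplify its
     inverse. *)
  assert (0 < (2 * (INR M + 1)) * (4 * (INR M + 1) - 1) - 1) by nra.
  field; repeat split; nra.
Qed.

Lemma is_lim_seq_inv_affine (c : R) :
  0 <= c -> is_lim_seq (fun n => / (4 * INR (S n) + c)) 0.
Proof.
intros Hc.
apply (is_lim_seq_inv _ p_infty); [| discriminate].
apply is_lim_seq_le_p_loc with (u := INR); [| apply is_lim_seq_INR].
exists 0%nat; intros n _; rewrite S_INR; assert (H := pos_INR n); lra.
Qed.

Theorem corollary3p10 :
  is_infinite_product_from1
    (fun n => / (1 - 1 / (2 * INR n * (4 * INR n - 1))))
    (lemniscate / 2).
Proof.
destruct lemn_moment_0_cv as [L HL].
rewrite (lemniscate_half_of_cv L HL).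
unfold is_infinite_product_from1.
(* With [M = S N], replacing [I (4M+3)] in the partial product by [I (4M)] gives
   [L (4M+2) / (4M+1)], the upper bound; replacing it by [I (4M+4)] brings in the factor
   [(4M+1) / (4M+3)] and gives [L (4M+2) / (4M+3)], the lower bound. *)
apply is_lim_seq_le_le with
  (u := fun N => L * (1 - / (4 * INR (S N) + 3)))
  (w := fun N => L * (1 + / (4 * INR (S N) + 1))).
- intros N; rewrite partial_product_moment_ratio.
  set (M := S N).
  assert (HM := pos_INR M).
  assert (Ha := moment_ratio_gt0 0 M).
  assert (H4 := lemn_moment_cv 0 M L HL).
  assert (H4' := lemn_moment_cv 0 (S M) L HL).
  assert (H3 := lemn_moment_cv 3 M _ lemn_moment_3_cv).
  assert (Hup : moment_ratio 3 M * (1 / 2) <= moment_ratio 0 M * L)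
    by (apply (lemn_moment_lim_antitone (0 + 4 * M) (3 + 4 * M)); [lia | assumption ..]).
  assert (Hlow : moment_ratio 0 (S M) * L <= moment_ratio 3 M * (1 / 2))
    by (apply (lemn_moment_lim_antitone (3 + 4 * M) (0 + 4 * S M)); [lia | assumption ..]).
  cbn [moment_ratio] in Hlow.
  rewrite plus_INR, mult_INR, Rplus_0_l in Hlow.
  replace (INR 4) with 4 in Hlow by (simpl; ring).
  set (A := moment_ratio 0 M) in *; set (B := moment_ratio 3 M * (1 / 2)) in *.
  set (m := INR M) in *.
  (* The common positive factor by which both moment inequalities are multiplied; it turns [B] into
     the partial product. *)
  assert (Hc : 0 < (4 * m + 2) / (4 * m + 1) / A)
    by (repeat apply Rdiv_lt_0_compat; lra).
  split.
  + replace (L * (1 - / (4 * m + 3)))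
      with ((4 * m + 2) / (4 * m + 1) / A * ((4 * m + 1) / (4 * m + 3) * A * L))
      by (field; lra).
    replace ((4 * m + 2) / (4 * m + 1) * B / A)
      with ((4 * m + 2) / (4 * m + 1) / A * B) by (field; lra).
    apply Rmult_le_compat_l; lra.
  + replace (L * (1 + / (4 * m + 1)))
      with ((4 * m + 2) / (4 * m + 1) / A * (A * L)) by (field; lra).
    replace ((4 * m + 2) / (4 * m + 1) * B / A)
      with ((4 * m + 2) / (4 * m + 1) / A * B) by (field; lra).
    apply Rmult_le_compat_l; lra.
- replace (Finite L) with (Finite (L * (1 - 0))) by (f_equal; ring).
  apply (is_lim_seq_scal_l _ L (1 - 0)), is_lim_seq_minus';
    [apply is_lim_seq_const | apply is_lim_seq_inv_affine; lra].
- replace (Finite L) with (Finite (L * (1 + 0))) by (f_equal; ring).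
  apply (is_lim_seq_scal_l _ L (1 + 0)), is_lim_seq_plus';
    [apply is_lim_seq_const | apply is_lim_seq_inv_affine; lra].
Qed.
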